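(* Let $\Gamma$ be a general network. The relation $\preceq$ on $\mathcal{L}(\Gamma)$ defined by $l_1\preceq l_2$ if $l_1\mathring{\cup}l_2=l_2$ is a partial order relation on $\mathcal{L}(\Gamma)$.
   Context: A general network $\Gamma$ has a finite vertex set $\Gamma^0$ and a finite set $T$ of tensors. A tensor $t=T_A^B$ is given by a non-empty set $A\subseteq\Gamma^0$ of covariant indexes and a (possibly empty) set $B\subseteq\Gamma^0$ of contra-variant indexes; its index set is $I(t)=A\cup B$. A 2-chain is an unordered pair $\oplus(t_i,t_j)$ of distinct tensors $t_i,t_j\in T$ with $I(t_i)\cap I(t_j)\neq\emptyset$. A (non-empty) tensor chain is $\oplus(P|S)$, where $P\subseteq T$ is non-empty, $S$ is a set of 2-chains between elements of $P$, and the pair is connected: any two distinct $t_i,t_j\in P$ are joined by a sequence $t_i=t_{k_1},\dots,t_{k_m}=t_j$ in $P$ with $\oplus(t_{k_\ell},t_{k_{\ell+1}})\in S$ for all $1\le \ell<m$. A tensor chain is determined by $(P,S)$; a single tensor $t$ is the chain with $P=\{t\}$, $S=\varnothing$. $\mathcal{L}(\Gamma)$ is the set of all non-empty tensor chains together with an extra element $\emptyset$ (the empty relation), whose tensor set is regarded as empty. Reducing: for non-empty chains $l_1=\oplus(P_1|S_1)$, $l_2=\oplus(P_2|S_2)$, put $l_1\mathring{\cup}l_2=\oplus(P_1\cup P_2|S_1\cup S_2)$ if $P_1\cap P_2\neq\varnothing$ and $l_1\mathring{\cup}l_2=\emptyset$ otherwise; also $\emptyset\mathring{\cup}l=l\mathring{\cup}\emptyset=\emptyset$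 for all $l$. *)

(* Defs.v *)
From HB Require Import structures.
From mathcomp Require Import all_boot.

Set Implicit Arguments.
Unset Strict Implicit.
Unset Printing Implicit Defensive.

(* The set T of tensors is a finite type equipped with index maps, so distinct
   tensors are allowed, but not required, to have the same index sets. *)
Record network := Network {
  vertex : finType;
  tensor : finType;
  covariant : tensor -> {set vertex};
  contravariant : tensor -> {set vertex};
  covariant_neq0 : forall t, covariant t != set0
}.

Definition index_set (G : network) (t : tensor G) : {set vertex G} :=
  covariant t :|: contravariant t.

(* The unordered pair of ti and tj is the two-element set [set ti; tj]. *)
Definition two_chain (G : network) (s : {set tensor G}) : bool :=
  [exists ti, exists tj,
    [&& ti != tj, index_set ti :&: index_set tj != set0 & s == [set ti; tj]]].

Definition linked (G : network) (P : {set tensor G})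
    (S : {set {set tensor G}}) : rel (tensor G) :=
  [rel ti tj | [&& ti \in P, tj \in P & [set ti; tj] \in S]].

Definition is_chain (G : network) (P : {set tensor G})
    (S : {set {set tensor G}}) : bool :=
  [&& P != set0,
      [forall s in S, two_chain s && (s \subset P)] &
      [forall ti in P, forall tj in P,
         (ti != tj) ==> connect (linked P S) ti tj]].

Record chain (G : network) := Chain {
  chain_val : {set tensor G} * {set {set tensor G}};
  chain_valP : is_chain chain_val.1 chain_val.2
}.

HB.instance Definition _ (G : network) := [isSub for @chain_val G].
HB.instance Definition _ (G : network) := [Finite of chain G by <:].

Definition tensors (G : network) (l : chain G) : {set tensor G} :=
  (chain_val l).1.
Definition two_chains (G : network) (l : chain G) : {set {set tensor G}} :=
  (chain_val l).2.

(* [None] is the empty relation. *)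
Definition chains (G : network) := option (chain G).

Lemma linkedS (G : network) (P P' : {set tensor G})
    (S S' : {set {set tensor G}}) :
  P \subset P' -> S \subset S' ->
  subrel (connect (linked P S)) (connect (linked P' S')).
Proof.
move=> sP sS; apply: connect_sub => x y /= /and3P[xP yP xyS].
by apply: connect1; apply/and3P; split;
  [apply: (subsetP sP) | apply: (subsetP sP) | apply: (subsetP sS)].
Qed.

Lemma is_chainU (G : network) (l1 l2 : chain G) :
  tensors l1 :&: tensors l2 != set0 ->
  is_chain (tensors l1 :|: tensors l2) (two_chains l1 :|: two_chains l2).
Proof.
rewrite /tensors /two_chains.
case: l1 l2 => [[P1 S1] /= c1] [[P2 S2] /= c2] /set0Pn[t /setIP[tP1 tP2]].
case/and3P: c1 => P1n0 /forall_inP S1P /forall_inP C1.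
case/and3P: c2 => _ /forall_inP S2P /forall_inP C2.
set C := connect (linked (P1 :|: P2) (S1 :|: S2)).
have K1 x y : x \in P1 -> y \in P1 -> C x y.
  move=> xP yP; have [->|xy] := eqVneq x y; first exact: connect0.
  have /forall_inP/(_ y yP)/implyP/(_ xy) := C1 x xP.
  by apply: linkedS; rewrite subsetUl.
have K2 x y : x \in P2 -> y \in P2 -> C x y.
  move=> xP yP; have [->|xy] := eqVneq x y; first exact: connect0.
  have /forall_inP/(_ y yP)/implyP/(_ xy) := C2 x xP.
  by apply: linkedS; rewrite subsetUr.
apply/and3P; split.
- by apply/set0Pn; exists t; rewrite inE tP1.
- apply/forall_inP => s /setUP[/S1P|/S2P] /andP[-> sP] /=.
    by rewrite (subset_trans sP) ?subsetUl.
  by rewrite (subset_trans sP) ?subsetUr.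
- apply/forall_inP => x xP; apply/forall_inP => y yP; apply/implyP => _.
  apply: (@connect_trans _ _ t).
    by case/setUP: xP => xP; [apply: K1 | apply: K2].
  by case/setUP: yP => yP; [apply: K1 | apply: K2].
Qed.

Definition chainU (G : network) (l1 l2 : chain G)
    (h : tensors l1 :&: tensors l2 != set0) : chain G :=
  @Chain G (tensors l1 :|: tensors l2, two_chains l1 :|: two_chains l2)
    (is_chainU h).

Definition reduce (G : network) (l1 l2 : chains G) : chains G :=
  match l1, l2 with
  | Some c1, Some c2 =>
      match @idP (tensors c1 :&: tensors c2 != set0) with
      | ReflectT h => Some (chainU h)
      | ReflectF _ => None
      end
  | _, _ => None
  end.

Definition chain_le (G : network) : rel (chains G) :=
  fun l1 l2 => reduce l1 l2 == l2.

(* Main.v *)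
(* The empty relation is the top element, and since tensor sets of chains are
   non-empty, the order on non-empty chains is componentwise inclusion. *)
Require Import Defs.
From HB Require Import structures.
From mathcomp Require Import all_boot.

(** A union equals its second argument exactly when it contains the first, so by [chain_le_Some] the
    axioms come from set inclusion in each component; [None] is added as a top. *)

Lemma tensors_neq0 (G : network) (c : chain G) : tensors c != set0.
Proof. by have /and3P[] := chain_valP c. Qed.

Lemma chain_le_None (G : network) (l : chains G) : chain_le l None.
Proof. by case: l. Qed.

Lemma chain_le_Some (G : network) (c1 c2 : chain G) :
  chain_le (Some c1) (Some c2) =
  (tensors c1 \subset tensors c2) && (two_chains c1 \subset two_chains c2).
Proof.
rewrite /chain_le /reduce; case: {-}_ / idP => [h|/negP h].
  rewrite [LHS](inj_eq Some_inj) -val_eqE /= /tensors /two_chains.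
  by case: (chain_val c2) => P S; rewrite xpair_eqE !(sameP eqP setUidPr).
(* Inclusion would make the intersection equal to [tensors c1], which is non-empty. *)
apply/esym/negbTE; apply: contra h => /andP[/setIidPl-> _].
exact: tensors_neq0.
Qed.

Theorem proposition4p1 (G : network) :
  [/\ reflexive (@chain_le G),
      antisymmetric (@chain_le G) &
      transitive (@chain_le G)].
Proof.
split.
- by move=> [c|]; rewrite ?chain_le_None // chain_le_Some !subxx.
- move=> [c1|] [c2|] //.
  rewrite !chain_le_Some => /andP[/andP[P12 S12] /andP[P21 S21]].
  congr Some; apply: val_inj; apply/eqP.
  rewrite /= (surjective_pairing (chain_val c1)).
  rewrite (surjective_pairing (chain_val c2)) xpair_eqE !eqEsubset.
  by apply/andP; split; apply/andP.
- move=> y x [c3|]; last by rewrite !chain_le_None.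
  (* Only non-empty chains lie below a non-empty chain. *)
  case: y => [c2|]; last by [].
  case: x => [c1|]; last discriminate 1.
  rewrite !chain_le_Some => /andP[P12 S12] /andP[P23 S23].
  by rewrite (subset_trans P12) ?(subset_trans S12).
Qed.
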